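(* Let $\Box^{\top}:=\mathsf S_{\mathfrak R}\Box^{\#}\mathsf N_{\mathfrak R}:\mathbf{IStr}\to\mathbf{IStr}$ and $\Box^{\ddag}:=C^{-1}\Box^{\top}C:\mathfrak H^{+}\to\mathfrak H^{+}$. If $\phi:G\to G'$ is a morphism in $\mathbf{IStr}$, then \begin{itemize} \item $G^{\top}=(\check E(G),\check V(G),\{(e,v):(v,e)\in I(G)\})$, \item $\phi^{\top}=(\check E(\phi),\check V(\phi))$. \end{itemize} If $\varphi:H\to H'$ is a morphism in $\mathfrak H^{+}$, then \begin{itemize} \item $H^{\ddag}$ is the set-system hypergraph with vertex set $E(H)$, edge set $V(H)$, and $\epsilon_{H^{\ddag}}(v)=\{e\in E(H):v\in\epsilon_H(e)\}$ for $v\in V(H)$; \item $\varphi^{\ddag}$ acts on vertices of $H^{\ddag}$ as $E^{+}(\varphi)$ and on edges of $H^{\ddag}$ as $V^{+}(\varphi)$. \end{itemize}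
   Context: Juxtaposition of functors denotes composition; $\mathcal P$ is the covariant power-set functor, $\mathcal P(f)(A)=\{f(x):x\in A\}$. $\mathfrak R$ (incidence hypergraphs): objects $G=(\check V(G),\check E(G),I(G),\varsigma_G,\omega_G)$ with functions $\varsigma_G:I(G)\to\check V(G)$, $\omega_G:I(G)\to\check E(G)$; morphisms are triples of functions $(\check V(\phi),\check E(\phi),I(\phi))$ commuting with $\varsigma$ and $\omega$. $\mathbf{IStr}$ (incidence structures): objects $G=(\check V(G),\check E(G),I(G))$ with $I(G)\subseteq\check V(G)\times\check E(G)$; a morphism $\phi=(\check V(\phi),\check E(\phi))$ is a pair of functions with $(v,e)\in I(G)\Rightarrow(\check V(\phi)(v),\check E(\phi)(e))\in I(G')$. $\mathfrak H^{+}$: objects are set-system hypergraphs $G=(E(G),\epsilon_G,V(G))$, $\epsilon_G:E(G)\to\mathcal P(V(G))$; morphisms are weak set-system homomorphisms, pairs of functions $(E^{+}(\phi),V^{+}(\phi))$ with $E^{+}(\phi):E(G)\to E(H)$, $V^{+}(\phi):V(G)\to V(H)$ and $\mathcal P(V^{+}(\phi))(\epsilon_G(e))\subseteq\epsilon_H(E^{+}(\phi)(e))$ for all $e\in E(G)$. $\mathsf N_{\mathfrak R}:\mathbf{IStr}\to\mathfrak R$: $G\mapsto(\check V(G),\check E(G),I(G),\varsigma,\omega)$ with $\varsigma(v,e)=v$, $\omega(v,e)=e$; $(f,g)\mapsto(f,g,(v,e)\mapsto(f(v),g(e)))$. $\mathsf S_{\mathfrak R}:\mathfrak R\to\mathbf{IStr}$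 (its left adjoint): $G\mapsto(\check V(G),\check E(G),\{(\varsigma_G(j),\omega_G(j)):j\in I(G)\})$, $\phi\mapsto(\check V(\phi),\check E(\phi))$. Incidence dual $\Box^{\#}:\mathfrak R\to\mathfrak R$: $G^{\#}=(\check E(G),\check V(G),I(G),\omega_G,\varsigma_G)$, $\phi^{\#}=(\check E(\phi),\check V(\phi),I(\phi))$. $C:\mathfrak H^{+}\to\mathbf{IStr}$ is the isomorphism of categories $C(G)=(V(G),E(G),\{(v,e):v\in\epsilon_G(e)\})$, $C(\phi)=(V^{+}(\phi),E^{+}(\phi))$, whose inverse sends $H$ to $(\check E(H),\epsilon_H,\check V(H))$ with $\epsilon_H(e)=\{v:(v,e)\in I(H)\}$ and $\varphi$ to $(\check E(\varphi),\check V(\varphi))$. *)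

(* Defs.v *)
From mathcomp Require Import all_boot.
From mathcomp Require Import boolp classical_sets.

Set Implicit Arguments.
Unset Strict Implicit.
Unset Printing Implicit Defensive.

Local Open Scope classical_set_scope.

Record category := Category {
  obj :> Type;
  hom : obj -> obj -> Type;
  idm : forall x, hom x x;
  compm : forall x y z, hom y z -> hom x y -> hom x z;
  idlm : forall x y (f : hom x y), compm (idm y) f = f;
  idrm : forall x y (f : hom x y), compm f (idm x) = f;
  compmA : forall x y z t (h : hom z t) (g : hom y z) (f : hom x y),
    compm h (compm g f) = compm (compm h g) f }.

Record functor (C D : category) := Functor {
  fobj :> C -> D;
  fmap : forall x y : C, hom x y -> hom (fobj x) (fobj y);
  fmap1 : forall x : C, fmap (idm x) = idm (fobj x);
  fmap_comp : forall (x y z : C) (g : hom y z) (f : hom x y),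
    fmap (compm g f) = compm (fmap g) (fmap f) }.

Section FunctorComp.
Variables (C D E : category) (F : functor D E) (G : functor C D).

Let compmap (x y : C) (f : hom x y) : hom (F (G x)) (F (G y)) :=
  fmap F (fmap G f).

Fact functor_comp1 (x : C) : compmap (idm x) = idm (F (G x)).
Proof. by rewrite /compmap !fmap1. Qed.

Fact functor_compM (x y z : C) (g : hom y z) (f : hom x y) :
  compmap (compm g f) = compm (compmap g) (compmap f).
Proof. by rewrite /compmap !fmap_comp. Qed.

Definition functor_comp : functor C E :=
  Functor functor_comp1 functor_compM.
End FunctorComp.

Notation "F \oF G" := (functor_comp F G) (at level 50, left associativity).

(* A morphism bundled with its endpoints; equality of functors is equality of
   their actions on arrows. *)
Definition arrow (C : category) := {x : C & {y : C & hom x y}}.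
Definition Arrow (C : category) (x y : C) (f : hom x y) : arrow C :=
  existT _ x (existT _ y f).

Record inc_hypergraph := IncHypergraph {
  ihV : Type;
  ihE : Type;
  ihI : Type;
  ih_vert : ihI -> ihV;
  ih_edge : ihI -> ihE }.

Record inc_hypergraph_hom (G H : inc_hypergraph) := IncHypergraphHom {
  ihomV : ihV G -> ihV H;
  ihomE : ihE G -> ihE H;
  ihomI : ihI G -> ihI H;
  ihom_vert : forall i, ih_vert (ihomI i) = ihomV (ih_vert i);
  ihom_edge : forall i, ih_edge (ihomI i) = ihomE (ih_edge i) }.

Lemma inc_hypergraph_hom_eq (G H : inc_hypergraph)
    (f g : inc_hypergraph_hom G H) :
  ihomV f = ihomV g -> ihomE f = ihomE g -> ihomI f = ihomI g -> f = g.
Proof.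
case: f g => [fV fE fI p q] [gV gE gI p' q'] /= eV eE eI; subst.
by rewrite (Prop_irrelevance p p') (Prop_irrelevance q q').
Qed.

Definition inc_hypergraph_id (G : inc_hypergraph) : inc_hypergraph_hom G G :=
  @IncHypergraphHom G G id id id (fun=> erefl) (fun=> erefl).

Definition inc_hypergraph_comp (G H K : inc_hypergraph)
    (g : inc_hypergraph_hom H K) (f : inc_hypergraph_hom G H) :
  inc_hypergraph_hom G K.
Proof.
refine (@IncHypergraphHom G K (ihomV g \o ihomV f) (ihomE g \o ihomE f)
  (ihomI g \o ihomI f) _ _) => i /=.
- by rewrite !ihom_vert.
- by rewrite !ihom_edge.
Defined.

Definition catR : category.
Proof.
refine (@Category inc_hypergraph inc_hypergraph_hom inc_hypergraph_id
  inc_hypergraph_comp _ _ _).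
all: by move=> *; exact: inc_hypergraph_hom_eq.
Defined.

Record inc_structure := IncStructure {
  isV : Type;
  isE : Type;
  isI : set (isV * isE) }.

Arguments isI : clear implicits.

Record inc_structure_hom (G H : inc_structure) := IncStructureHom {
  shomV : isV G -> isV H;
  shomE : isE G -> isE H;
  shomI : forall v e, isI G (v, e) -> isI H (shomV v, shomE e) }.

Lemma inc_structure_hom_eq (G H : inc_structure)
    (f g : inc_structure_hom G H) :
  shomV f = shomV g -> shomE f = shomE g -> f = g.
Proof.
case: f g => [fV fE p] [gV gE p'] /= eV eE; subst.
by rewrite (Prop_irrelevance p p').
Qed.

Definition inc_structure_id (G : inc_structure) : inc_structure_hom G G :=
  @IncStructureHom G G id id (fun _ _ => id).

Definition inc_structure_comp (G H K : inc_structure)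
    (g : inc_structure_hom H K) (f : inc_structure_hom G H) :
  inc_structure_hom G K :=
  @IncStructureHom G K (shomV g \o shomV f) (shomE g \o shomE f)
    (fun v e ve => shomI g (shomI f ve)).

Definition catIStr : category.
Proof.
refine (@Category inc_structure inc_structure_hom inc_structure_id
  inc_structure_comp _ _ _).
all: by move=> *; exact: inc_structure_hom_eq.
Defined.

Record ss_hypergraph := SSHypergraph {
  ssE : Type;
  ssV : Type;
  ss_eps : ssE -> set ssV }.

Arguments ss_eps : clear implicits.

Record ss_weak_hom (G H : ss_hypergraph) := SSWeakHom {
  whomE : ssE G -> ssE H;
  whomV : ssV G -> ssV H;
  whom_sub : forall e, whomV @` ss_eps G e `<=` ss_eps H (whomE e) }.

Lemma ss_weak_hom_eq (G H : ss_hypergraph) (f g : ss_weak_hom G H) :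
  whomE f = whomE g -> whomV f = whomV g -> f = g.
Proof.
case: f g => [fE fV p] [gE gV p'] /= eE eV; subst.
by rewrite (Prop_irrelevance p p').
Qed.

Definition ss_weak_id (G : ss_hypergraph) : ss_weak_hom G G.
Proof.
by refine (@SSWeakHom G G id id _) => e v [w ? <-].
Defined.

Definition ss_weak_comp (G H K : ss_hypergraph)
    (g : ss_weak_hom H K) (f : ss_weak_hom G H) : ss_weak_hom G K.
Proof.
refine (@SSWeakHom G K (whomE g \o whomE f) (whomV g \o whomV f) _).
move=> e _ [v ev <-] /=; apply: whom_sub; exists (whomV f v) => //.
by apply: whom_sub; exists v.
Defined.

Definition catHplus : category.
Proof.
refine (@Category ss_hypergraph ss_weak_hom ss_weak_id ss_weak_comp _ _ _).
all: by move=> *; exact: ss_weak_hom_eq.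
Defined.

(* The incidence relation, a set of pairs, becomes the type of incidences. *)
Definition nerveR_obj (G : inc_structure) : inc_hypergraph :=
  @IncHypergraph (isV G) (isE G) (set_type (isI G))
    (fun i => (val i).1) (fun i => (val i).2).

Lemma nerveR_inc (G H : inc_structure) (f : inc_structure_hom G H)
    (i : set_type (isI G)) :
  (shomV f (val i).1, shomE f (val i).2) \in isI H.
Proof. by case: i => [[v e] /= /set_mem ve]; exact/mem_set/shomI. Qed.

Definition nerveR_map (G H : inc_structure) (f : inc_structure_hom G H) :
    inc_hypergraph_hom (nerveR_obj G) (nerveR_obj H) :=
  @IncHypergraphHom (nerveR_obj G) (nerveR_obj H) (shomV f) (shomE f)
    (fun i => exist _ (shomV f (val i).1, shomE f (val i).2) (nerveR_inc f i))
    (fun=> erefl) (fun=> erefl).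

Definition nerveR : functor catIStr catR.
Proof.
refine (@Functor catIStr catR nerveR_obj nerveR_map _ _).
- move=> G; apply: inc_hypergraph_hom_eq => //=.
  by apply/funext => i; apply: val_inj => /=; case: (val i).
- move=> G H K g f; apply: inc_hypergraph_hom_eq => //=.
  by apply/funext => i; apply: val_inj.
Defined.

(* Left adjoint of nerveR: parallel incidences are identified. *)
Definition simpR_obj (G : inc_hypergraph) : inc_structure :=
  @IncStructure (ihV G) (ihE G)
    [set (ih_vert j, ih_edge j) | j in [set: ihI G]].

Definition simpR_map (G H : inc_hypergraph) (f : inc_hypergraph_hom G H) :
  inc_structure_hom (simpR_obj G) (simpR_obj H).
Proof.
refine (@IncStructureHom (simpR_obj G) (simpR_obj H) (ihomV f) (ihomE f) _).
move=> v e [j _ [<- <-]]; exists (ihomI f j) => //.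
by rewrite ihom_vert ihom_edge.
Defined.

Definition simpR : functor catR catIStr.
Proof.
refine (@Functor catR catIStr simpR_obj simpR_map _ _).
all: by move=> *; exact: inc_structure_hom_eq.
Defined.

Definition dualR_obj (G : inc_hypergraph) : inc_hypergraph :=
  @IncHypergraph (ihE G) (ihV G) (ihI G) (@ih_edge G) (@ih_vert G).

Definition dualR_map (G H : inc_hypergraph) (f : inc_hypergraph_hom G H) :
    inc_hypergraph_hom (dualR_obj G) (dualR_obj H) :=
  @IncHypergraphHom (dualR_obj G) (dualR_obj H) (ihomE f) (ihomV f) (ihomI f)
    (ihom_edge f) (ihom_vert f).

Definition dualR : functor catR catR.
Proof.
refine (@Functor catR catR dualR_obj dualR_map _ _).
all: by move=> *; exact: inc_hypergraph_hom_eq.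
Defined.

Definition isoC_obj (G : ss_hypergraph) : inc_structure :=
  @IncStructure (ssV G) (ssE G) [set p | ss_eps G p.2 p.1].

Definition isoC_map (G H : ss_hypergraph) (f : ss_weak_hom G H) :
  inc_structure_hom (isoC_obj G) (isoC_obj H).
Proof.
refine (@IncStructureHom (isoC_obj G) (isoC_obj H) (whomV f) (whomE f) _).
by move=> v e /= ve; apply: whom_sub; exists v.
Defined.

Definition isoC : functor catHplus catIStr.
Proof.
refine (@Functor catHplus catIStr isoC_obj isoC_map _ _).
all: by move=> *; exact: inc_structure_hom_eq.
Defined.

Definition isoC_inv_obj (H : inc_structure) : ss_hypergraph :=
  @SSHypergraph (isE H) (isV H) (fun e => [set v | isI H (v, e)]).

Definition isoC_inv_map (G H : inc_structure) (f : inc_structure_hom G H) :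
  ss_weak_hom (isoC_inv_obj G) (isoC_inv_obj H).
Proof.
refine (@SSWeakHom (isoC_inv_obj G) (isoC_inv_obj H) (shomE f) (shomV f) _).
by move=> e _ [v ve <-] /=; exact: shomI.
Defined.

Definition isoC_inv : functor catIStr catHplus.
Proof.
refine (@Functor catIStr catHplus isoC_inv_obj isoC_inv_map _ _).
all: by move=> *; exact: ss_weak_hom_eq.
Defined.

Lemma isoCK (G H : catHplus) (f : hom G H) :
  Arrow (fmap (isoC_inv \oF isoC) f) = Arrow f.
Proof.
case: G H f => [EG VG eG] [EH VH eH] f.
rewrite -[RHS](f_equal (@Arrow catHplus (SSHypergraph eG) (SSHypergraph eH))
  (_ : isoC_inv_map (isoC_map f) = f)) //.
exact: (@ss_weak_hom_eq (SSHypergraph eG) (SSHypergraph eH)).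
Qed.

Lemma isoC_invK (G H : catIStr) (f : hom G H) :
  Arrow (fmap (isoC \oF isoC_inv) f) = Arrow f.
Proof.
have eqI (V E : Type) (A : set (V * E)) : [set p | A (p.1, p.2)] = A.
  by apply/seteqP; split => -[].
have eqA (V E V' E' : Type) (A B : set (V * E)) (A' B' : set (V' * E'))
    (f1 : inc_structure_hom (IncStructure A) (IncStructure A'))
    (f2 : inc_structure_hom (IncStructure B) (IncStructure B')) :
    A = B -> A' = B' -> shomV f1 = shomV f2 -> shomE f1 = shomE f2 ->
    @Arrow catIStr _ _ f1 = @Arrow catIStr _ _ f2.
  move=> eA eA'; subst => eV eE.
  by rewrite (inc_structure_hom_eq eV eE).
case: G H f => [VG EG IG] [VH EH IH] f.
by apply: eqA => //=; exact: eqI.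
Qed.

Definition dual_top : functor catIStr catIStr := simpR \oF dualR \oF nerveR.

Definition dual_ddag : functor catHplus catHplus :=
  isoC_inv \oF dual_top \oF isoC.

(* Main.v *)
Require Import Defs.
From mathcomp Require Import all_boot.
From mathcomp Require Import boolp classical_sets.

Local Open Scope classical_set_scope.

(** Incidences of [nerveR G] are the pairs of the relation itself; [dualR] swaps their two
    projections, and [simpR] takes the image, which is the transposed relation. All carriers and
    morphism components agree by computation, so only this relation and its fibres [ss_eps] need set
    extensionality. *)

Lemma isI_dual_top (G : catIStr) :
  isI (dual_top G) = [set (p.2, p.1) | p in isI G].
Proof.
apply/seteqP; split.
- by move=> _ [[p /= Gp] _ <-]; exists p => //; exact: set_mem.
- by move=> _ [p Gp <-]; exists (exist _ p (mem_set Gp)).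
Qed.

(** [isoC_inv] reads off the fibre over [v] of the transposed relation of [isoC H]. *)
Lemma ss_eps_dual_ddag (H : catHplus) :
  ss_eps (dual_ddag H) = (fun v : ssV H => [set e : ssE H | ss_eps H e v]).
Proof.
apply/funext => v; apply/seteqP; split => e.
- by move=> [[[w f] /= /set_mem Hp] _ [<- <-]].
- by move=> He; exists (exist _ (v, e) (mem_set (He : isI (isoC H) (v, e)))).
Qed.

Theorem lemma5p2 :
  (forall (G G' : catIStr) (phi : hom G G'),
    [/\ dual_top G =
          @IncStructure (isE G) (isV G)
            [set (p.2, p.1) | p in isI G],
        shomV (fmap dual_top phi) = shomE phi &
        shomE (fmap dual_top phi) = shomV phi]) /\
  (forall (H H' : catHplus) (varphi : hom H H'),
    [/\ dual_ddag H =
          @SSHypergraph (ssV H) (ssE H)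
            (fun v : ssV H => [set e : ssE H | ss_eps H e v]),
        whomV (fmap dual_ddag varphi) = whomE varphi &
        whomE (fmap dual_ddag varphi) = whomV varphi]).
Proof.
split=> [G G' phi | H H' varphi]; split=> //.
- exact: (f_equal (@IncStructure (isE G) (isV G)) (isI_dual_top G)).
- exact: (f_equal (@SSHypergraph (ssV H) (ssE H)) (ss_eps_dual_ddag H)).
Qed.
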